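(* Let $(M,\nabla,g)$ be an affine Riemannian manifold of dimension $n$, let $\chi$ be a given $(0,2)$-tensor on $M$, let $h=h(x,u)$ be a given function, and let $F(A)=f(\lambda_1,\dots,\lambda_n)$ be a smooth symmetric function of the eigenvalues $\lambda_1,\dots,\lambda_n$ of $A$ with $f_i=\partial f/\partial\lambda_i>0$ for all $i$. (1) If $u\in C^2(M,\mathbb{R})$ satisfies $$F\big(g^{ip}(\chi_{jp}+u_{jp})\big)=h(x,u)$$ on $M$, then $u\circ\pi$ satisfies $$F\big((g^T)^{i\bar p}(\chi^T_{j\bar p}+4(u\circ\pi)_{j\bar p})\big)=h(\pi(x),u\circ\pi)$$ on $TM$ (here $x$ denotes a point of $TM$). (2) If $u\in C^2(M\times\mathbb{R},\mathbb{R})$, $u=u(x,t)$, satisfies $$F\big(g^{ip}(\chi_{jp}+u_{jp})\big)-u_t=h(x,u)$$ on $M\times\mathbb{R}$, then $u\circ\pi:=u(\pi(\cdot),\cdot)$ satisfies $$F\big((g^T)^{i\bar p}(\chi^T_{j\bar p}+4(u\circ\pi)_{j\bar p})\big)-(u\circ\pi)_t=h(\pi(x),u\circ\pi)$$ on $TM\times\mathbb{R}$.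
   Context: An affine manifold (also called flat manifold) $(M,\nabla)$ is a smooth manifold with a connection $\nabla$ whose torsion and curvature vanish. Around every point there are affine coordinate systems $\{x^1,\dots,x^n\}$, i.e. local coordinates with $\nabla_{\partial/\partial x^i}\partial/\partial x^j=0$; coordinate changes between them are affine transformations. An affine Riemannian manifold $(M,\nabla,g)$ is an affine manifold with a Riemannian metric $g$. In affine coordinates, $u_{jp}=(\nabla du)_{jp}=\partial^2u/\partial x^j\partial x^p$ (derivatives in the space variable only). The argument of $F$ in the equations on $M$ is $A^i_j=g^{ip}\alpha_{jp}$, where $\alpha=\chi+\nabla du$; the equations are independent of the choice of affine coordinate system. Let $\pi:TM\to M$ be the tangent bundle. Given affine coordinates $\{x^1,\dots,x^n\}$ on an open subset of $M$, put $\xi^j=x^j\circ\pi$, $\xi^{n+j}=dx^j$ (the $j$-th fibre coordinate) and $z^j=\xi^j+\sqrt{-1}\,\xi^{n+j}$. The $\{z^1,\dots,z^n\}$ are holomorphic coordinates defining a complex structure $J_\nabla$ on $TM$. Put $g^T=\sum_{i,j}(g_{ij}\circ\pi)\,dz^id\bar z^j$, a Hermitian metric on $(TM,J_\nabla)$ with components $g^T_{i\bar j}=g_{ij}\circ\pi$ and inverse $(g^T)^{i\bar p}$, and similarly $\chi^T=\sum_{i,j}(\chi_{ij}\circ\pi)\,dz^id\bar z^j$, with components $\chi^T_{i\bar j}=\chi_{ij}\circ\pi$. For a function $v$ on $TM$, $v_{j\bar p}=\partial^2v/\partial z^j\partial\bar z^p$. *)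

(* Defs.v *)
From HB Require Import structures.
From mathcomp Require Import all_boot all_order all_algebra all_fingroup.
From mathcomp Require Import all_classical all_reals all_analysis.
From mathcomp Require Import complex.

Set Implicit Arguments.
Unset Strict Implicit.
Unset Printing Implicit Defensive.

Import Order.TTheory GRing.Theory Num.Theory.
Import numFieldNormedType.Exports.

Local Open Scope classical_set_scope.
Local Open Scope ring_scope.

Definition pder (R : realType) (m : nat) (i : 'I_m) (w : 'rV[R]_m -> R) :
    'rV[R]_m -> R :=
  fun y => 'D_('e_i) w y.

Definition iter_pder (R : realType) (m : nat) (s : seq 'I_m)
    (w : 'rV[R]_m -> R) : 'rV[R]_m -> R :=
  foldr (@pder R m) w s.

(* U is meant to be open; partial derivatives of order < k are required to be
   Frechet-differentiable, which for k-fold continuous partial differentiability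
   is automatic. *)
Definition Ck_on (R : realType) (m k : nat) (U : set 'rV[R]_m)
    (w : 'rV[R]_m -> R) : Prop :=
  forall (s : seq 'I_m) (y : 'rV[R]_m), U y ->
    ((size s <= k)%N -> {for y, continuous (iter_pder s w)}) /\
    ((size s < k)%N -> differentiable (iter_pder s w) y).

Definition smooth_on (R : realType) (m : nat) (U : set 'rV[R]_m)
    (w : 'rV[R]_m -> R) : Prop :=
  forall k : nat, Ck_on k U w.

(* For functions of (xi^1,...,xi^2n), with z^j = xi^j + i xi^{n+j}. *)
Definition cpder (R : realType) (m : nat) (i : 'I_m) (w : 'rV[R]_m -> R[i]) :
    'rV[R]_m -> R[i] :=
  fun y => Complex (pder i (fun y' => complex.Re (w y')) y)
                   (pder i (fun y' => complex.Im (w y')) y).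

Definition d_dz (R : realType) (n : nat) (j : 'I_n)
    (w : 'rV[R]_(n + n) -> R[i]) : 'rV[R]_(n + n) -> R[i] :=
  fun y => 2^-1 * (cpder (lshift n j) w y - 'i%C * cpder (rshift n j) w y).

Definition d_dzbar (R : realType) (n : nat) (j : 'I_n)
    (w : 'rV[R]_(n + n) -> R[i]) : 'rV[R]_(n + n) -> R[i] :=
  fun y => 2^-1 * (cpder (lshift n j) w y + 'i%C * cpder (rshift n j) w y).

(* Only the values of [crd] on [dom], and those of [icrd] on [img], matter. *)
Record chart (R : realType) (n : nat) (T : topologicalType) := Chart {
  dom : set T;
  crd : T -> 'rV[R]_n;
  icrd : 'rV[R]_n -> T;
  dom_open : open dom;
  img_open : open (crd @` dom);
  crdK : forall x, dom x -> icrd (crd x) = x;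
  crd_continuous : forall x, dom x -> {for x, continuous crd};
  icrd_continuous : forall y, (crd @` dom) y -> {for y, continuous icrd}
}.

Definition img (R : realType) (n : nat) (T : topologicalType)
    (c : chart R n T) : set 'rV[R]_n :=
  crd c @` dom c.

(* The i-th coordinate of c', expressed in the coordinates c. *)
Definition transition (R : realType) (n : nat) (T : topologicalType)
    (c c' : chart R n T) (i : 'I_n) : 'rV[R]_n -> R :=
  fun y => crd c' (icrd c y) 0 i.

Definition compatible (R : realType) (n : nat) (T : topologicalType)
    (c c' : chart R n T) : Prop :=
  forall i : 'I_n,
    smooth_on (crd c @` (dom c `&` dom c')) (transition c c' i) /\
    smooth_on (crd c' @` (dom c `&` dom c')) (transition c' c i).

Record smoothManifold (R : realType) (n : nat) := SmoothManifold {
  carrier :> topologicalType;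
  atlas : set (chart R n carrier);
  carrier_hausdorff : hausdorff_space carrier;
  carrier_second_countable : @second_countable carrier;
  atlas_cover : forall x : carrier, exists2 c, atlas c & dom c x;
  atlas_compatible : forall c c', atlas c -> atlas c' -> compatible c c';
  atlas_maximal : forall c, (forall c', atlas c' -> compatible c c') -> atlas c
}.

(* jac c c' x p i = d x'^i / d x^p  at the point x,
   where x^p, x'^i are the coordinates c, c'. *)
Definition jac (R : realType) (n : nat) (T : topologicalType)
    (c c' : chart R n T) (x : T) : 'M[R]_n :=
  \matrix_(p < n, i < n) pder p (transition c c' i) (crd c x).

(* d^2 x'^m / d x^i d x^j  at the point x. *)
Definition hess (R : realType) (n : nat) (T : topologicalType)
    (c c' : chart R n T) (x : T) (m i j : 'I_n) : R :=
  pder i (pder j (transition c c' m)) (crd c x).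

Definition overlap (R : realType) (n : nat) (M : smoothManifold R n)
    (c c' : chart R n M) (x : M) : Prop :=
  [/\ atlas c, atlas c', dom c x & dom c' x].

Definition Ck (R : realType) (n : nat) (M : smoothManifold R n) (k : nat)
    (u : M -> R) : Prop :=
  forall c, atlas c -> Ck_on k (img c) (fun y => u (icrd c y)).

Definition Ck_time (R : realType) (n : nat) (M : smoothManifold R n) (k : nat)
    (u : M -> R -> R) : Prop :=
  forall c, atlas c ->
    Ck_on k [set y : 'rV[R]_(n + 1) | img c (lsubmx y)]
      (fun y : 'rV[R]_(n + 1) => u (icrd c (lsubmx y)) (rsubmx y 0 0)).

(* Tensor fields and connections are given by their components in every chart of
   the atlas, subject to the transformation laws. *)

Record tensor02 (R : realType) (n : nat) (M : smoothManifold R n) := Tensor02 {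
  comp02 :> chart R n M -> M -> 'M[R]_n;
  comp02_law : forall c c' x, overlap c c' x ->
    forall i j, comp02 c' x i j =
      \sum_(p < n) \sum_(q < n)
        jac c' c x i p * jac c' c x j q * comp02 c x p q
}.

Record riemannianMetric (R : realType) (n : nat) (M : smoothManifold R n) :=
    RiemannianMetric {
  metric :> tensor02 M;
  metric_smooth : forall c i j, atlas c ->
    smooth_on (img c) (fun y => metric c (icrd c y) i j);
  metric_sym : forall c x, atlas c -> dom c x ->
    forall i j, metric c x i j = metric c x j i;
  metric_posdef : forall c x, atlas c -> dom c x ->
    forall v : 'rV[R]_n, v != 0 ->
      0 < \sum_(i < n) \sum_(j < n) v 0 i * v 0 j * metric c x i j
}.

(* [Gamma c x k i j] is Gamma^k_{ij}:
   nabla_{d/dx^i} d/dx^j = sum_k Gamma^k_{ij} d/dx^k. *)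
Record connection (R : realType) (n : nat) (M : smoothManifold R n) :=
    Connection {
  Gamma :> chart R n M -> M -> 'I_n -> 'I_n -> 'I_n -> R;
  Gamma_smooth : forall c k i j, atlas c ->
    smooth_on (img c) (fun y => Gamma c (icrd c y) k i j);
  Gamma_law : forall c c' x, overlap c c' x ->
    forall k i j, Gamma c' x k i j =
      \sum_(r < n) jac c c' x r k *
        (hess c' c x r i j +
         \sum_(p < n) \sum_(q < n)
           jac c' c x i p * jac c' c x j q * Gamma c x r p q)
}.

Definition torsion (R : realType) (n : nat) (M : smoothManifold R n)
    (nabla : connection M) (c : chart R n M) (x : M) (k i j : 'I_n) : R :=
  nabla c x k i j - nabla c x k j i.

(* R(d_i, d_j) d_k = sum_l R^l_{ijk} d_l. *)
Definition curvature (R : realType) (n : nat) (M : smoothManifold R n)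
    (nabla : connection M) (c : chart R n M) (x : M) (l i j k : 'I_n) : R :=
  pder i (fun y => nabla c (icrd c y) l j k) (crd c x)
  - pder j (fun y => nabla c (icrd c y) l i k) (crd c x)
  + \sum_(m < n) (nabla c x l i m * nabla c x m j k
                  - nabla c x l j m * nabla c x m i k).

Record affineManifold (R : realType) (n : nat) := AffineManifold {
  affine_base :> smoothManifold R n;
  nabla : connection affine_base;
  nabla_torsion_free : forall c x, atlas c -> dom c x ->
    forall k i j, torsion nabla c x k i j = 0;
  nabla_flat : forall c x, atlas c -> dom c x ->
    forall l i j k, curvature nabla c x l i j k = 0
}.

Definition affine_coordinates (R : realType) (n : nat)
    (M : affineManifold R n) (c : chart R n M) : Prop :=
  atlas c /\ forall x, dom c x -> forall k i j, nabla M c x k i j = 0.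

(* (nabla du)_{jp} = (nabla_{d_j} du)(d_p). *)
Definition nabla_du (R : realType) (n : nat) (M : affineManifold R n)
    (u : M -> R) (c : chart R n M) (x : M) : 'M[R]_n :=
  let ul := fun y => u (icrd c y) in
  \matrix_(j < n, p < n)
    (pder j (pder p ul) (crd c x)
     - \sum_(k < n) nabla M c x k j p * pder k ul (crd c x)).

(* A tangent vector is the family of its components in the charts around its
   base point; [tcomp_out] fixes the irrelevant values, so that equality of
   tangent vectors is the intended one. *)
Record tangent (R : realType) (n : nat) (M : smoothManifold R n) := Tangent {
  tbase : M;
  tcomp : chart R n M -> 'rV[R]_n;
  tcomp_law : forall c c', overlap c c' tbase ->
    tcomp c' = tcomp c *m jac c c' tbase;
  tcomp_out : forall c, ~ (atlas c /\ dom c tbase) -> tcomp c = 0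
}.

(* (xi^1, ..., xi^2n) = (x^1 o pi, ..., x^n o pi, dx^1, ..., dx^n). *)
Definition tcrd (R : realType) (n : nat) (M : smoothManifold R n)
    (c : chart R n M) (tau : tangent M) : 'rV[R]_(n + n) :=
  row_mx (crd c (tbase tau)) (tcomp tau c).

(* A function on TM read in the coordinates xi: these are injective on
   pi^{-1}(dom c), with image (img c) x R^n, so that for y in this image there
   is exactly one value to pick. *)
Definition tlocal (R : realType) (n : nat) (M : smoothManifold R n)
    (c : chart R n M) (v : tangent M -> R) (y : 'rV[R]_(n + n)) : R :=
  xget 0 [set r | exists tau : tangent M,
                    [/\ dom c (tbase tau), tcrd c tau = y & v tau = r]].

Definition complex_hessian (R : realType) (n : nat) (M : smoothManifold R n)
    (v : tangent M -> R) (c : chart R n M) (tau : tangent M) : 'M[R[i]]_n :=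
  \matrix_(j < n, p < n)
    d_dz j (d_dzbar p (fun y => (tlocal c v y)%:C%C)) (tcrd c tau).

(* Components alpha_{ij} o pi of alpha^T = sum (alpha_ij o pi) dz^i dzbar^j. *)
Definition lift02 (R : realType) (n : nat) (M : smoothManifold R n)
    (alpha : tensor02 M) (c : chart R n M) (tau : tangent M) : 'M[R[i]]_n :=
  map_mx (real_complex R) (alpha c (tbase tau)).

Definition eigenvalues_are (R : realType) (n : nat) (A : 'M[R[i]]_n)
    (lambda : 'rV[R]_n) : Prop :=
  char_poly A = \prod_(i < n) ('X - ((lambda 0 i)%:C%C)%:P).

(* chi is not assumed symmetric, so that the eigenvalues need not be real in
   general; F is only applied where they are, and form a point of the domain D of
   f. *)
Definition F_defined (R : realType) (n : nat) (D : set 'rV[R]_n)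
    (A : 'M[R[i]]_n) : Prop :=
  exists2 lambda, eigenvalues_are A lambda & D lambda.

(* The order of the eigenvalues picked is irrelevant, as f is symmetric. *)
Definition F_of (R : realType) (n : nat) (f : 'rV[R]_n -> R) (A : 'M[R[i]]_n) :
    R :=
  f (xget 0 [set lambda | eigenvalues_are A lambda]).

(* D is the domain of f: all of R^n, or for instance the positive cone for
   f = sum_i ln lambda_i. *)
Definition smooth_symmetric_increasing (R : realType) (n : nat)
    (D : set 'rV[R]_n) (f : 'rV[R]_n -> R) : Prop :=
  [/\ open D,
      forall lambda (s : 'S_n), D lambda -> D (col_perm s lambda),
      forall lambda (s : 'S_n), D lambda -> f (col_perm s lambda) = f lambda,
      smooth_on D f &
      forall lambda (i : 'I_n), D lambda -> 0 < pder i f lambda].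

(* If G = (g_{jp}), then (g^{ip}) is characterised by
   sum_p g^{ip} g_{jp} = delta^i_j, i.e. it is (G^T)^{-1}; this returns
   A^i_j = sum_p g^{ip} alpha_{jp}. *)
Definition raise_index (C : comUnitRingType) (n : nat) (G alpha : 'M[C]_n) :
    'M[C]_n :=
  \matrix_(i < n, j < n) \sum_(p < n) invmx G^T i p * alpha j p.

Definition M_matrix (R : realType) (n : nat) (M : affineManifold R n)
    (g : riemannianMetric M) (chi : tensor02 M) (u : M -> R)
    (c : chart R n M) (x : M) : 'M[R]_n :=
  raise_index (g c x) (chi c x + nabla_du u c x).

Definition TM_matrix (R : realType) (n : nat) (M : affineManifold R n)
    (g : riemannianMetric M) (chi : tensor02 M) (v : tangent M -> R)
    (c : chart R n M) (tau : tangent M) : 'M[R[i]]_n :=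
  raise_index (lift02 g c tau)
    (lift02 chi c tau + 4%:R *: complex_hessian v c tau).

Definition elliptic_on_M (R : realType) (n : nat) (M : affineManifold R n)
    (g : riemannianMetric M) (chi : tensor02 M) (h : M -> R -> R)
    (D : set 'rV[R]_n) (f : 'rV[R]_n -> R) (u : M -> R) : Prop :=
  forall (c : chart R n M) (x : M), affine_coordinates c -> dom c x ->
    let A := map_mx (real_complex R) (M_matrix g chi u c x) in
    F_defined D A /\ F_of f A = h x (u x).

Definition elliptic_on_TM (R : realType) (n : nat) (M : affineManifold R n)
    (g : riemannianMetric M) (chi : tensor02 M) (h : M -> R -> R)
    (D : set 'rV[R]_n) (f : 'rV[R]_n -> R) (v : tangent M -> R) : Prop :=
  forall (c : chart R n M) (tau : tangent M),
    affine_coordinates c -> dom c (tbase tau) ->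
    let A := TM_matrix g chi v c tau in
    F_defined D A /\ F_of f A = h (tbase tau) (v tau).

Definition parabolic_on_M (R : realType) (n : nat) (M : affineManifold R n)
    (g : riemannianMetric M) (chi : tensor02 M) (h : M -> R -> R)
    (D : set 'rV[R]_n) (f : 'rV[R]_n -> R) (u : M -> R -> R) : Prop :=
  forall (c : chart R n M) (x : M) (t : R), affine_coordinates c -> dom c x ->
    let A := map_mx (real_complex R) (M_matrix g chi (u^~ t) c x) in
    F_defined D A /\ F_of f A - derive1 (u x) t = h x (u x t).

Definition parabolic_on_TM (R : realType) (n : nat) (M : affineManifold R n)
    (g : riemannianMetric M) (chi : tensor02 M) (h : M -> R -> R)
    (D : set 'rV[R]_n) (f : 'rV[R]_n -> R) (v : tangent M -> R -> R) : Prop :=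
  forall (c : chart R n M) (tau : tangent M) (t : R),
    affine_coordinates c -> dom c (tbase tau) ->
    let A := TM_matrix g chi (v^~ t) c tau in
    F_defined D A /\ F_of f A - derive1 (v tau) t = h (tbase tau) (v tau t).

(* Main.v *)
(** In affine coordinates [nabla] has no Christoffel symbols, so that
    [u_{jp} = d^2 u / dx^j dx^p].  In the coordinates [z^j = xi^j + i xi^{n+j}] the
    function [u o pi] depends on the real parts [xi^j] only, hence
    [d^2 (u o pi) / dz^j dzbar^p = u_{jp} o pi / 4], and the matrix fed to [F] on
    [TM] is literally the complexification of the one fed to [F] on [M].  That
    [u o pi] read in the coordinates [xi] is the expected function rests on every
    [n]-tuple being the components of some tangent vector, which is the chain rule
    for transition functions. *)
Require Import Defs.
From HB Require Import structures.
From mathcomp Require Import all_boot all_order all_algebra all_fingroup.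
From mathcomp Require Import all_classical all_reals all_analysis.
From mathcomp Require Import complex.

Set Implicit Arguments.
Unset Strict Implicit.
Unset Printing Implicit Defensive.

Import Order.TTheory GRing.Theory Num.Theory.
Import numFieldNormedType.Exports.

Local Open Scope classical_set_scope.
Local Open Scope ring_scope.

Lemma pder_comp (R : realType) (m k : nat) (phi : 'rV[R]_m -> 'rV[R]_k)
    (G : 'rV[R]_k -> R) (a : 'rV[R]_m) (p : 'I_m) :
  (forall i, differentiable (fun y => phi y 0 i) a) ->
  differentiable G (phi a) ->
  pder p (fun y => G (phi y)) a =
    \sum_(i < k) pder p (fun y => phi y 0 i) a * pder i G (phi a).
Proof.
move=> dphi dG.
(* Differentiability of [phi] comes from that of its components, through the finite sum
   [phi = \sum_i phi_i *: 'e_i]. *)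
have dphi' : differentiable phi a.
  have -> : phi = \sum_(i < k) (fun y => phi y 0 i *: 'e_i).
    by apply/funext => y; rewrite fct_sumE {1}[phi y]row_sum_delta.
  by apply: differentiable_sum => i; apply: differentiableZl.
rewrite /pder deriveE; last exact: differentiable_comp.
rewrite (diff_comp dphi' dG) /= -(deriveE _ dphi').
rewrite derive_mx; last exact: diff_derivable.
rewrite [X in 'd G _ X]row_sum_delta linear_sum; apply: eq_bigr => i _.
by rewrite linearZ /= mxE -deriveE.
Qed.

(** * Jacobians of chart changes and vectors of the tangent bundle *)

(* [dom] is qualified because fingroup's notation of that name shadows it. *)
Section Charts.
Variables (R : realType) (n : nat) (M : smoothManifold R n).
Implicit Types (c : chart R n M) (x : M).

Lemma img_crd c x : Defs.dom c x -> img c (crd c x).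
Proof. by move=> cx; exists x. Qed.

Lemma dom_icrd c (y : 'rV[R]_n) : img c y -> Defs.dom c (icrd c y).
Proof. by move=> [x cx <-]; rewrite crdK. Qed.

Lemma icrdK c (y : 'rV[R]_n) : img c y -> crd c (icrd c y) = y.
Proof. by move=> [x cx <-]; rewrite crdK. Qed.

Lemma near_img c x : Defs.dom c x -> \forall y \near crd c x, img c y.
Proof. by move=> cx; apply: open_nbhs_nbhs; split; [exact: img_open|exists x]. Qed.

Lemma near_dom c c' x : Defs.dom c x -> Defs.dom c' x ->
  \forall y \near crd c x, Defs.dom c' (icrd c y).
Proof.
move=> cx c'x.
apply: (@icrd_continuous _ _ _ c _ (img_crd cx)); rewrite crdK//.
by apply: open_nbhs_nbhs; split => //; exact: dom_open.
Qed.

Lemma transition_differentiable c c' x i : overlap c c' x ->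
  differentiable (transition c c' i) (crd c x).
Proof.
move=> [ac ac' cx c'x].
have [+ _] := atlas_compatible ac ac' i.
move=> /(_ 1%N [::] (crd c x)) -[]; first by exists x.
by move=> _; apply.
Qed.

Lemma jac_id c x : Defs.dom c x -> jac c c x = 1%:M.
Proof.
move=> cx; apply/matrixP => p i; rewrite !mxE /pder.
rewrite (@near_eq_derive _ _ _ _ (fun y : 'rV[R]_n => y 0 i)); last first.
  apply: filterS (near_img cx) => y cy.
  by rewrite /transition icrdK.
have /matrixP/(_ 0 i) := @derive_mx _ _ 1 n id (crd c x) 'e_p (@derivable_id _ _ _ _).
by rewrite derive_id !mxE eqxx eq_sym => <-.
Qed.

(** Chain rule: passing from [c] to [c''] factors through [c'], but only near [crd c x], where the
    points still lie in the domain of [c']. *)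
Lemma jacM c c' c'' x : overlap c c' x -> overlap c' c'' x ->
  jac c c' x *m jac c' c'' x = jac c c'' x.
Proof.
move=> cc' c'c''; have [_ _ cx c'x] := cc'.
apply/matrixP => p i; rewrite !mxE /pder.
rewrite [RHS](@near_eq_derive _ _ _ _
    (fun y : 'rV[R]_n => transition c' c'' i (crd c' (icrd c y)))); last first.
  by apply: filterS (near_dom cx c'x) => y c'y; rewrite /transition crdK.
rewrite [RHS]pder_comp ?crdK//.
- by apply: eq_bigr => k _; rewrite !mxE.
- by move=> k; exact: transition_differentiable cc'.
- exact: transition_differentiable c'c''.
Qed.

(** The components [b] in [c] are carried to every other chart around [x] by the Jacobian; the
    cocycle identity [jacM] is then the transformation law. *)
Lemma tangent_with_components c x (b : 'rV[R]_n) : atlas c -> Defs.dom c x ->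
  exists2 tau : tangent M, tbase tau = x & tcomp tau c = b.
Proof.
move=> ac cx.
pose b' c' := if pselect (atlas c' /\ Defs.dom c' x) then b *m jac c c' x else 0.
have b'E c' : atlas c' -> Defs.dom c' x -> b' c' = b *m jac c c' x.
  by move=> ac' c'x; rewrite /b'; case: pselect => // -[].
have law c' c'' : overlap c' c'' x -> b' c'' = b' c' *m jac c' c'' x.
  move=> ov; have [ac' ac'' c'x c''x] := ov.
  by rewrite !b'E// -mulmxA jacM.
have out c' : ~ (atlas c' /\ Defs.dom c' x) -> b' c' = 0.
  by rewrite /b'; case: pselect.
by exists (Tangent law out) => //=; rewrite b'E// jac_id// mulmx1.
Qed.

Lemma tlocal_base c (u : M -> R) (y : 'rV[R]_(n + n)) :
  atlas c -> img c (lsubmx y) ->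
  tlocal c (fun tau => u (tbase tau)) y = u (icrd c (lsubmx y)).
Proof.
move=> ac cy; rewrite /tlocal.
have [tau tauE tauc] := @tangent_with_components c _ (rsubmx y) ac (dom_icrd cy).
(* Any competitor [tau'] has the same base point, read off from the first half of [y], hence the
   same value. *)
apply: xget_unique => [|r [tau' [ctau' <- <-]]].
  exists tau; split; rewrite ?tauE//; first exact: dom_icrd.
  by rewrite /tcrd tauE tauc icrdK// hsubmxK.
by rewrite /tcrd row_mxKl crdK.
Qed.

End Charts.

(** * Directional derivatives and functions of the first block of coordinates *)

Section DeriveLine.
Variables (K : numFieldType) (V V' W : normedModType K).
Variables (f : V -> W) (g : V' -> W) (a v : V) (a' v' : V').
Hypothesis fg : forall t : K, f (t *: v + a) = g (t *: v' + a').

Let slopeE : (fun t : K => t^-1 *: ((f \o shift a) (t *: v) - f a)) =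
             (fun t : K => t^-1 *: ((g \o shift a') (t *: v') - g a')).
Proof.
have := fg 0; rewrite !scale0r !add0r => fga.
by apply/funext => t /=; rewrite fg fga.
Qed.

(** A directional derivative sees only the restriction to a line, so [f] and [g] may live on
    different spaces. *)
Lemma derive_line : 'D_v f a = 'D_v' g a'.
Proof. by rewrite /derive slopeE. Qed.

Lemma derivable_line : derivable g a' v' -> derivable f a v.
Proof. by rewrite /derivable slopeE. Qed.

End DeriveLine.

Section Lsubmx.
Variables (R : realType) (n m : nat).
Implicit Types (w : 'rV[R]_n -> R) (y : 'rV[R]_(n + m)).

Lemma pder_lsubmx w y (p : 'I_n) :
  pder (lshift m p) (fun y' => w (lsubmx y')) y = pder p w (lsubmx y).
Proof.
apply: derive_line => t.
by rewrite linearD linearZ /= delta_mx_lshift row_mxKl.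
Qed.

Lemma pder_rshift_lsubmx w y (p : 'I_m) :
  pder (rshift n p) (fun y' => w (lsubmx y')) y = 0.
Proof.
rewrite -[RHS](derive_cst (w (lsubmx y)) y 'e_(rshift n p)).
apply: derive_line => t.
by rewrite linearD linearZ /= delta_mx_rshift row_mxKl scaler0 add0r.
Qed.

End Lsubmx.

(** * Complex derivatives of real functions *)

Lemma d_dz_real (R : realType) (n : nat) (j : 'I_n) (w : 'rV[R]_(n + n) -> R)
    (y : 'rV[R]_(n + n)) : pder (rshift n j) w y = 0 ->
  d_dz j (fun y' => (w y')%:C%C) y = (2^-1 * pder (lshift n j) w y)%:C%C.
Proof.
move=> wj; rewrite /d_dz /cpder /= wj /pder !derive_cst.
by rewrite rmorphM fmorphV rmorph_nat mulr0 subr0.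
Qed.

Lemma d_dzbar_real (R : realType) (n : nat) (j : 'I_n)
    (w : 'rV[R]_(n + n) -> R) (y : 'rV[R]_(n + n)) :
  pder (rshift n j) w y = 0 ->
  d_dzbar j (fun y' => (w y')%:C%C) y = (2^-1 * pder (lshift n j) w y)%:C%C.
Proof.
move=> wj; rewrite /d_dzbar /cpder /= wj /pder !derive_cst.
by rewrite rmorphM fmorphV rmorph_nat mulr0 addr0.
Qed.

Lemma near_eq_cpder (R : realType) (m : nat) (i : 'I_m) (F G : 'rV[R]_m -> R[i])
    (y : 'rV[R]_m) : (\near y, F y = G y) -> cpder i F y = cpder i G y.
Proof.
move=> FG; rewrite /cpder /pder; congr Complex; apply: near_eq_derive;
  by apply: filterS FG => z ->.
Qed.

Lemma near_eq_d_dz (R : realType) (n : nat) (j : 'I_n)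
    (F G : 'rV[R]_(n + n) -> R[i]) (y : 'rV[R]_(n + n)) :
  (\near y, F y = G y) -> d_dz j F y = d_dz j G y.
Proof. by move=> FG; rewrite /d_dz !(near_eq_cpder _ FG). Qed.

Lemma near_eq_d_dzbar (R : realType) (n : nat) (j : 'I_n)
    (F G : 'rV[R]_(n + n) -> R[i]) (y : 'rV[R]_(n + n)) :
  (\near y, F y = G y) -> d_dzbar j F y = d_dzbar j G y.
Proof. by move=> FG; rewrite /d_dzbar !(near_eq_cpder _ FG). Qed.

Lemma complex_hessian_base (R : realType) (n : nat) (M : smoothManifold R n)
    (c : chart R n M) (u : M -> R) (tau : tangent M) :
  atlas c -> Defs.dom c (tbase tau) ->
  (forall j p, derivable (pder p (fun y => u (icrd c y)))
     (crd c (tbase tau)) 'e_j) ->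
  complex_hessian (fun tau => u (tbase tau)) c tau =
    \matrix_(j, p) (4^-1 * pder j (pder p (fun y => u (icrd c y)))
                       (crd c (tbase tau)))%:C%C.
Proof.
move=> ac ctau du; apply/matrixP => j p; rewrite !mxE.
have open_timg : open [set y : 'rV[R]_(n + n) | img c (lsubmx y)].
  by apply: open_comp; [move=> ? _; exact: continuous_lsubmx | exact: img_open].
(* The inner derivative has to be known on a whole neighbourhood before [d_dz] is applied. Each of
   the two derivatives contributes a factor [2^-1]. *)
rewrite (@near_eq_d_dz _ _ _ _ (fun y : 'rV[R]_(n + n) =>
    (2^-1 * pder p (fun y => u (icrd c y)) (lsubmx y))%:C%C)).
  rewrite d_dz_real; last first.
    exact: (pder_rshift_lsubmx
      (fun a => 2^-1 * pder p (fun y => u (icrd c y)) a)).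
  rewrite (pder_lsubmx (fun a => 2^-1 * pder p (fun y => u (icrd c y)) a)).
  rewrite /tcrd row_mxKl {1}/pder deriveZ//; congr (_%:C%C).
  by rewrite /GRing.scale /= mulrA -invfM -natrM.
have : \forall y \near tcrd c tau, img c (lsubmx y).
  apply: open_nbhs_nbhs; split => //=.
  by rewrite /tcrd row_mxKl; exact: img_crd.
apply: filterS => y cy.
rewrite (@near_eq_d_dzbar _ _ _ _ (fun y : 'rV[R]_(n + n) =>
    (u (icrd c (lsubmx y)))%:C%C)); last first.
  have : \forall z \near y, img c (lsubmx z) by exact: open_nbhs_nbhs.
  by apply: filterS => z cz; rewrite tlocal_base.
rewrite d_dzbar_real; last exact: (pder_rshift_lsubmx (fun a => u (icrd c a))).
by rewrite (pder_lsubmx (fun a => u (icrd c a))).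
Qed.

(** A morphism out of a field commutes with matrix inversion. *)
Lemma map_raise_index (K : fieldType) (L : comUnitRingType)
    (phi : {rmorphism K -> L}) (n : nat) (G alpha : 'M[K]_n) :
  map_mx phi (raise_index G alpha) =
    raise_index (map_mx phi G) (map_mx phi alpha).
Proof.
apply/matrixP => i j; rewrite !mxE rmorph_sum; apply: eq_bigr => p _.
by rewrite rmorphM map_trmx -map_invmx !mxE.
Qed.

Lemma TM_matrix_base (R : realType) (n : nat) (M : affineManifold R n)
    (g : riemannianMetric M) (chi : tensor02 M) (u : M -> R)
    (c : chart R n M) (tau : tangent M) :
  affine_coordinates c -> Defs.dom c (tbase tau) ->
  (forall j p, derivable (pder p (fun y => u (icrd c y)))
     (crd c (tbase tau)) 'e_j) ->
  TM_matrix g chi (fun tau => u (tbase tau)) c tau =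
    map_mx (real_complex R) (M_matrix g chi u c (tbase tau)).
Proof.
move=> [ac nabla0] ctau du.
rewrite /TM_matrix /M_matrix map_raise_index complex_hessian_base//.
congr raise_index; rewrite map_mxD; congr (_ + _).
apply/matrixP => j p; rewrite !mxE big1 ?subr0 => [|k _]; last first.
  by rewrite nabla0// mul0r.
(* The factor 4 of the equation on the tangent bundle, seen as a real number, cancels the [4^-1] of
   the complex Hessian. *)
by rewrite -[4%:R](rmorph_nat (real_complex R)) -rmorphM mulVKf// pnatr_eq0.
Qed.

Lemma Ck_derivable_pder (R : realType) (n : nat) (M : smoothManifold R n)
    (u : M -> R) (c : chart R n M) (x : M) (j p : 'I_n) :
  Ck 2 u -> atlas c -> Defs.dom c x ->
  derivable (pder p (fun y => u (icrd c y))) (crd c x) 'e_j.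
Proof.
move=> u2 ac cx; apply: diff_derivable.
by have [_] := u2 _ ac [:: p] _ (img_crd cx); apply.
Qed.

Lemma Ck_time_derivable_pder (R : realType) (n : nat) (M : smoothManifold R n)
    (u : M -> R -> R) (t : R) (c : chart R n M) (x : M) (j p : 'I_n) :
  Ck_time 2 u -> atlas c -> Defs.dom c x ->
  derivable (pder p (fun y => u (icrd c y) t)) (crd c x) 'e_j.
Proof.
move=> u2 ac cx.
(* The slices of [U] at constant [t] inherit its regularity in [x]. *)
pose U (y : 'rV[R]_(n + 1)) := u (icrd c (lsubmx y)) (rsubmx y 0 0).
have pderU b : pder (lshift 1 p) U (row_mx b t%:M) =
    pder p (fun y => u (icrd c y) t) b.
  apply: derive_line => s.
  rewrite delta_mx_lshift scale_row_mx scaler0 add_row_mx add0r /U.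
  by rewrite !row_mxKl !row_mxKr !mxE mulr1n.
have cxt : img c (lsubmx (row_mx (crd c x) (t%:M : 'rV[R]_1))).
  by rewrite row_mxKl; exact: img_crd.
have [_ /(_ isT) dU] := u2 _ ac [:: lshift 1 p] _ cxt.
(* The line through [(crd c x, t)] in a space direction keeps the time equal to [t]. *)
apply: derivable_line (@diff_derivable _ _ _ _ _ 'e_(lshift 1 j) dU) => s.
by rewrite delta_mx_lshift scale_row_mx scaler0 add_row_mx add0r -pderU.
Qed.

Theorem theorem6p1 (R : realType) (n : nat) (M : affineManifold R n)
    (g : riemannianMetric M) (chi : tensor02 M) (h : M -> R -> R)
    (D : set 'rV[R]_n) (f : 'rV[R]_n -> R)
    (hf : smooth_symmetric_increasing D f) :
  (forall u : M -> R, Ck 2 u ->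
     elliptic_on_M g chi h D f u ->
     elliptic_on_TM g chi h D f (fun tau => u (tbase tau))) /\
  (forall u : M -> R -> R, Ck_time 2 u ->
     parabolic_on_M g chi h D f u ->
     parabolic_on_TM g chi h D f (fun tau t => u (tbase tau) t)).
Proof.
split=> u u2 uM c tau => [|t] affc ctau /=.
  rewrite (@TM_matrix_base _ _ _ _ _ u)//; first exact: uM.
  by move=> j p; apply: Ck_derivable_pder => //; case: affc.
(* At fixed [t] this is the elliptic argument; the time derivative at [tau] is already that of [u]
   at [tbase tau]. *)
rewrite (@TM_matrix_base _ _ _ _ _ (u^~ t))//; first exact: uM.
by move=> j p; apply: Ck_time_derivable_pder => //; case: affc.
Qed.
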